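(* Let $p\ge0$, $q>0$ be integers. Let $\alpha_1,\dots,\alpha_p,\ \beta_1,\dots,\beta_q,\ a_1,\dots,a_p,\ b_1,\dots,b_q,\ T$ be positive real numbers such that $\kappa:=\sum_{s=1}^q\beta_s-\sum_{r=1}^p\alpha_r\in\mathbb{Z}_{>0}$. Write $C:=\prod_{r=1}^p\alpha_r^{\alpha_r}\prod_{s=1}^q\beta_s^{-\beta_s}$. Let $\{\omega_{k}\}_{k\ge0}$ be a sequence of positive real numbers such that $\frac{\omega_{k+1}}{\omega_k}=1+O(\frac1k)$ as $k\to\infty$, and set $$H(x):=\sum_{k=0}^\infty\frac{\prod_{r=1}^p\Gamma(\alpha_rk+a_r)}{\prod_{s=1}^q\Gamma(\beta_sk+b_s)}\,\omega_k\,(Tx)^{\kappa k}.$$ Then, writing $H(x)=\sum_{n\ge0}H_nx^n$, the summands of $H(x)=\sum_{n\ge0}H_nx^n$ concentrate exponentially near $n\approx\kappa C^{1/\kappa}Tx$.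
   Context: Exponential concentration: a power series $I(x)=\sum_{n\ge0}a_nx^n\in\mathbb{R}[[x]]$ is absolutely monotonic if it converges for all $x>0$ and all $a_n\ge0$. Let $I\ne0$ be absolutely monotonic, $f(x)$ a real polynomial with positive leading term, and $C',\nu,\alpha,\beta>0$. Set $n_\pm(x):=\lfloor f(x)(1\pm C'x^{-\nu})\rfloor$. The summands of $I(x)$ concentrate exponentially near $n\approx f(x)$ with window term $C'x^{-\nu}$ and parameters $(\alpha,\beta)$ if, as $x\to+\infty$, $\frac{1}{I(x)}\sum_{n=0}^{n_-(x)}a_nx^n=O(e^{-\alpha x^\beta})$ and $\frac{1}{I(x)}\sum_{n=n_+(x)}^{\infty}a_nx^n=O(e^{-\alpha x^\beta})$. The summands of $I(x)$ concentrate exponentially near $n\approx f(x)$ if this holds for some $C',\nu,\alpha,\beta>0$. Empty products equal 1. The assertion includes that $H$ is absolutely monotonic. *)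

(* Defs.v *)
From HB Require Import structures.
From mathcomp Require Import all_boot all_order all_algebra.
From mathcomp Require Import all_classical all_reals all_analysis.
Import Order.TTheory GRing.Theory Num.Theory.
Import numFieldNormedType.Exports.

Set Implicit Arguments.
Unset Strict Implicit.
Unset Printing Implicit Defensive.

Local Open Scope classical_set_scope.
Local Open Scope ring_scope.

(* Lets [f =O_+oo g] be used for functions of a real variable. *)
Canonical pinfty_filter_on (R : numFieldType) : filter_on R :=
  FilterType (pinfty_nbhs R) (@proper_pinfty_nbhs R).

Definition Gamma (R : realType) (z : R) : R :=
  \int[@lebesgue_measure R]_(t in `]0, +oo[) (t `^ (z - 1) * expR (- t)).

(* A power series is represented by its sequence of coefficients. *)
Definition absolutely_monotonic (R : realType) (a : nat -> R) : Prop :=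
  (forall x : R, 0 < x -> cvgn (pseries a x)) /\ (forall n, 0 <= a n).

Definition n_minus (R : realType) (f : {poly R}) (C' nu x : R) : int :=
  Num.floor (f.[x] * (1 - C' * x `^ (- nu))).

Definition n_plus (R : realType) (f : {poly R}) (C' nu x : R) : int :=
  Num.floor (f.[x] * (1 + C' * x `^ (- nu))).

(* The sum over 0 <= n <= m; the condition n <= m makes it empty when m < 0,
   and is redundant otherwise. *)
Definition lower_sum (R : realType) (a : nat -> R) (m : int) (x : R) : R :=
  \sum_(0 <= n < `|m|%N.+1 | n%:Z <= m) a n * x ^+ n.

Definition upper_sum (R : realType) (a : nat -> R) (m : int) (x : R) : R :=
  limn (fun N : nat => \sum_(0 <= n < N | m <= n%:Z) a n * x ^+ n).

Definition concentrate_exponentially_with (R : realType) (a : nat -> R)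
    (f : {poly R}) (C' nu alpha beta : R) : Prop :=
  (fun x : R => (limn (pseries a x))^-1 * lower_sum a (n_minus f C' nu x) x)
    =O_+oo (fun x : R => expR (- alpha * x `^ beta)) /\
  (fun x : R => (limn (pseries a x))^-1 * upper_sum a (n_plus f C' nu x) x)
    =O_+oo (fun x : R => expR (- alpha * x `^ beta)).

Definition concentrate_exponentially (R : realType) (a : nat -> R)
    (f : {poly R}) : Prop :=
  [/\ absolutely_monotonic a,
      exists n, a n != 0,
      0 < lead_coef f &
      exists C' nu alpha beta : R,
        [/\ 0 < C', 0 < nu, 0 < alpha, 0 < beta &
            concentrate_exponentially_with a f C' nu alpha beta]].

Definition gamma_quotient (R : realType) (p q : nat)
    (alpha a : 'I_p -> R) (beta b : 'I_q -> R) (k : nat) : R :=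
  (\prod_(r < p) Gamma (alpha r * k%:R + a r)) /
  (\prod_(s < q) Gamma (beta s * k%:R + b s)).

(* [powers_coef c kappa] is the coefficient sequence, in powers of x, of the
   series \sum_k c k * x ^+ (kappa * k), for kappa > 0. *)
Definition powers_coef (R : realType) (c : nat -> R) (kappa n : nat) : R :=
  if (kappa %| n)%N then c (n %/ kappa)%N else 0.

Lemma powers_coefE (R : realType) (c : nat -> R) (kappa : nat) (x : R) (N : nat) :
  (0 < kappa)%N ->
    pseries (powers_coef c kappa) x (kappa * N)%N =
    \sum_(0 <= k < N) c k * x ^+ (kappa * k).
Proof.
move=> k0; rewrite /pseries /series /=; elim: N => [|N IH].
  by rewrite muln0 !big_geq.
rewrite big_nat_recr//= -IH (@big_cat_nat _ _ _ (kappa * N)%N) ?leq_mul2l ?leqnSn ?orbT//=.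
congr (_ + _).
rewrite big_ltn ?ltn_pmul2l// {1}/powers_coef dvdn_mulr// mulKn//.
rewrite big_nat_cond big1 ?addr0// => i /andP[/andP[lo hi] _].
rewrite /powers_coef ifN ?mul0r//; apply/negP => /dvdnP[m im].
move: lo hi; rewrite im (mulnC m) !ltn_pmul2l// ltnS => /leq_trans/[apply].
by rewrite ltnn.
Qed.

(* Main.v *)
Require Import Defs.
From HB Require Import structures.
From mathcomp Require Import all_boot all_order all_algebra.
From mathcomp Require Import all_classical all_reals all_analysis.
From mathcomp Require Import ring lra.
Import Order.TTheory GRing.Theory Num.Theory.
Import numFieldNormedType.Exports.

(** Write c k for the coefficient of x ^ (kappa k) in H, and
    t_k = c k * x ^ (kappa k) for the corresponding summand.

    The Gamma function satisfies Gamma (z + c) / Gamma z ~ z ^ c with relative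
    error O(1/z), and omega k.+1 / omega k = 1 + O(1/k), so that
    t_(k+1) / t_k = (N / k) ^ kappa * (1 + O(1/k)), where
    N = C ^ (1 / kappa) * T * x.  Hence the summands increase up to k = N and
    decrease afterwards, which locates the peak at n = kappa N.

    At relative distance at least eta from N the ratio of consecutive summands
    stays away from 1 by a factor of about exp (eta).  Going from relative
    distance 2 eta to relative distance eta crosses about N eta indices, so every
    summand at distance 2 eta or more is at most exp (- N eta ^ 2 / 2) times
    another summand, and a fortiori times H(x), up to a constant factor.  Below
    the peak there are O(x) such summands; above it they are dominated by a
    geometric series whose sum costs a factor 1 + 1 / eta.  With
    eta = x ^ (- 1/4) the exponent N eta ^ 2 is a multiple of x ^ (1/2), and
    half of it absorbs these polynomial factors.

    The Gamma ratio is controlled without Stirling's formula.  Young's inequality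
    (c + 1) u <= c + u ^ (c + 1), at u = (z + c) / t and at u = t / (z - 1),
    integrates together with Gamma (z + 1) = z * Gamma z to
    (z - 1) ^ c <= Gamma (z + c) / Gamma z <= (z + c) ^ c (Gamma_add_ge and
    Gamma_add_le).  These bounds, and the one on omega, are combined in
    near_one_coef_ratio, and near_one_shift turns the factor 1 + O(1/k) into a
    shift of k by a constant D, which is the form in which concentrate_of_ratio
    uses it. *)

Local Open Scope classical_set_scope.
Local Open Scope ring_scope.

(** * The Gamma function *)

Section gamma.
Context {R : realType}.
Implicit Types z t x : R.
Local Notation mu := (@lebesgue_measure R).

Definition gamma_integrand z t : R := t `^ (z - 1) * expR (- t).

(** The half-line is exhausted by compact intervals on which the integrand is
    smooth even when z < 1.  The bounds use n + 2 so that the interval has a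
    nonempty interior for n = 0. *)
Definition gamma_itv (n : nat) : set R := `[n.+2%:R^-1, n.+2%:R]%classic.

Definition Gamma_trunc (n : nat) z : R :=
  \int[mu]_(t in gamma_itv n) gamma_integrand z t.

Lemma gamma_itv_gt0 n t : gamma_itv n t -> 0 < t.
Proof. by rewrite /gamma_itv/= in_itv/= => /andP[+ _]; apply: lt_le_trans. Qed.

Lemma gamma_itv_lt n : n.+2%:R^-1 < n.+2%:R :> R.
Proof. by rewrite (@lt_trans _ _ 1)// ?invf_lt1 ?ltr1n. Qed.

Lemma gamma_itv_measurable n : measurable (gamma_itv n).
Proof. exact: measurable_itv. Qed.

Lemma gamma_itv_bigcup : \bigcup_n gamma_itv n = `]0, +oo[%classic.
Proof.
apply/seteqP; split=> [t [n _ /gamma_itv_gt0 t0]|t].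
  by rewrite /= in_itv/= t0.
rewrite /= in_itv/= andbT => t0.
exists (Num.truncn (t + t^-1)) => //=.
have h : t + t^-1 < (Num.truncn (t + t^-1)).+2%:R.
  apply: lt_le_trans (truncnS_gt _) _; rewrite ler_nat//.
have i0 : 0 < t^-1 by rewrite invr_gt0.
rewrite /gamma_itv/= in_itv/=; apply/andP; split; last lra.
by rewrite -[leRHS]invrK lef_pV2 ?posrE// ltW// (lt_trans _ h)// ltrDr.
Qed.

Lemma gamma_itv_nd : nondecreasing_seq gamma_itv.
Proof.
apply/nondecreasing_seqP => n; rewrite subsetEset => t.
rewrite /gamma_itv/= !in_itv/= => /andP[h1 h2]; apply/andP; split.
  by apply: le_trans h1; rewrite lef_pV2 ?posrE// ler_nat.
by apply: le_trans h2 _; rewrite ler_nat.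
Qed.

Lemma is_derive_expRN (x c : R) :
  is_derive x 1 (fun t => expR (- (c * t))) (- c * expR (- (c * x))).
Proof.
by apply: is_derive_eq; rewrite /GRing.scale/= mulr1 mulrC.
Qed.

Lemma gamma_integrand_derivable z x : 0 < x ->
  derivable (gamma_integrand z) x 1.
Proof.
move=> x0; apply: derivableM.
  by apply: ex_derive; exact: is_derive1_powR.
have := is_derive_expRN x 1.
rewrite (_ : (fun t => expR (- (1 * t))) = (fun t => expR (- t))).
  by move=> [].
by apply/funext => t; rewrite mul1r.
Qed.

Lemma gamma_integrand_ge0 z t : 0 <= gamma_integrand z t.
Proof. by rewrite mulr_ge0 ?powR_ge0 ?expR_ge0. Qed.

Lemma within_continuous_gamma_itv (f : R -> R) n :
  (forall x, 0 < x -> derivable f x 1) ->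
  {within gamma_itv n, continuous f}.
Proof.
move=> df; apply: derivable_within_continuous => x xI; apply: df.
exact: (@gamma_itv_gt0 n).
Qed.

Lemma gamma_itv_integrable (f : R -> R) n :
  (forall x, 0 < x -> derivable f x 1) ->
  mu.-integrable (gamma_itv n) (EFin \o f).
Proof.
move=> df; apply: continuous_compact_integrable.
  exact: segment_compact.
exact: within_continuous_gamma_itv.
Qed.

Lemma derivable_gamma_itv_LRcontinuous (f : R -> R) n :
  (forall x, 0 < x -> derivable f x 1) ->
  derivable_oo_LRcontinuous f n.+2%:R^-1 n.+2%:R.
Proof.
move=> df; have c0 : 0 < n.+2%:R^-1 :> R by [].
have cf x : 0 < x -> {for x, continuous f}.
  by move=> x0; apply/differentiable_continuous/derivable1_diffP/df.
split.
- move=> x; rewrite in_itv/= => /andP[h _]; apply: df; exact: lt_trans h.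
- by apply: cvg_at_right_filter; apply: cf.
- by apply: cvg_at_left_filter; apply: cf.
Qed.

(** Integration by parts on a compact interval, where the boundary terms are
    explicit.  The recurrence of Gamma is its limit, and it also carries the
    boundedness of the truncated integrals from z + 1 down to z. *)
Lemma Gamma_trunc_recurrence n z :
  Gamma_trunc n (z + 1) = z * Gamma_trunc n z
   + ((n.+2%:R^-1) `^ z * expR (- n.+2%:R^-1) - n.+2%:R `^ z * expR (- n.+2%:R)).
Proof.
have ex1 : (fun t : R => expR (- (1 * t))) = (fun t => expR (- t)).
  by apply/funext => t; rewrite mul1r.
have dE x : is_derive x 1 (fun t : R => - expR (- t)) (expR (- x)).
  have := is_derive_expRN x 1; rewrite ex1 mul1r => h.
  by have := is_deriveN h; rewrite mulN1r opprK.
have dP x : 0 < x -> derivable (fun t => t `^ z) x 1.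
  by move=> x0; apply: ex_derive; exact: is_derive1_powR.
have dP1 x : 0 < x -> derivable (fun t => z * t `^ (z - 1)) x 1.
  move=> x0; apply: derivableM => //.
  by apply: ex_derive; exact: is_derive1_powR.
have := @Rintegration_by_parts R (fun t => t `^ z) (fun t => - expR (- t))
  (fun t => z * t `^ (z - 1)) (fun t => expR (- t)) n.+2%:R^-1 n.+2%:R.
move=> /(_ (gamma_itv_lt n)) /(_ (within_continuous_gamma_itv _ n dP1))
  /(_ (derivable_gamma_itv_LRcontinuous _ n dP)).
have gP : {in `](n.+2%:R^-1 : R), n.+2%:R[%R,
    (fun t : R => t `^ z)^`()%classic =1 (fun t : R => z * t `^ (z - 1))}.
  move=> x; rewrite in_itv/= => /andP[h _].
  by rewrite powR_derive1// in_itv/= andbT (lt_trans _ h).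
move=> /(_ gP).
have dE1 x : derivable (fun t : R => expR (- t)) x 1.
  by have := is_derive_expRN x 1; rewrite ex1 => -[].
have c2 : {within gamma_itv n, continuous (fun t : R => expR (- t))}.
  by apply: within_continuous_gamma_itv => x _; exact: dE1.
move=> /(_ c2).
have d2 : forall x, 0 < x -> derivable (fun t : R => - expR (- t)) x 1.
  by move=> x _; have [] := dE x.
move=> /(_ (derivable_gamma_itv_LRcontinuous _ n d2)).
have g2 : {in `](n.+2%:R^-1 : R), n.+2%:R[%R, (fun t : R => - expR (- t))^`()%classic =1
    (fun t => expR (- t))}.
  by move=> x _; rewrite derive1E; have [_] := dE x.
move=> /(_ g2) h.
rewrite /Gamma_trunc /gamma_integrand.
transitivity (\int[mu]_(x in gamma_itv n) (x `^ z * expR (- x))).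
  by apply: eq_Rintegral => x _; rewrite addrK.
rewrite h.
have -> : \int[mu]_(x in gamma_itv n) (z * x `^ (z - 1) * - expR (- x)) =
    - z * \int[mu]_(x in gamma_itv n) (x `^ (z - 1) * expR (- x)).
  rewrite -RintegralZl//; last 2 first.
    exact: gamma_itv_measurable.
    by apply: gamma_itv_integrable => x x0; exact: gamma_integrand_derivable.
  by apply: eq_Rintegral => x _; rewrite mulrN mulNr mulrA.
by ring.
Qed.

(** This is s <= exp s at s = c t / w, raised to the power w. *)
Lemma powR_le_expR (c w t : R) : 0 < c -> 0 < w -> 0 <= t ->
  t `^ w <= (w / c) `^ w * expR (c * t).
Proof.
move=> c0 w0 t0.
have -> : expR (c * t) = expR (c / w * t) `^ w.
  by rewrite -expRM; congr expR; field; rewrite gt_eqF.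
rewrite -powRM ?expR_ge0//; last by rewrite divr_ge0// ltW.
apply: ge0_ler_powR; rewrite ?nnegrE//; first exact: ltW.
  by rewrite mulr_ge0 ?expR_ge0// divr_ge0// ltW.
rewrite [leLHS](_ : t = w / c * (c / w * t)); last by field; rewrite !gt_eqF.
rewrite ler_wpM2l ?divr_ge0 ?ltW//.
by have := expR_ge1Dx (c / w * t); lra.
Qed.

Lemma integral_expRN_half_le n :
  \int[mu]_(t in gamma_itv n) expR (- (2^-1 * t)) <= 2.
Proof.
have dF (x : R) : is_derive x 1 (fun t => - 2 * expR (- (2^-1 * t)))
    (expR (- (2^-1 * x))).
  have h := is_derive_expRN x 2^-1.
  by apply: is_derive_eq; rewrite /GRing.scale/=; field.
have df (x : R) : 0 < x -> derivable (fun t => expR (- (2^-1 * t))) x 1.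
  by move=> _; have [] := is_derive_expRN x 2^-1.
have dF' (x : R) : 0 < x -> derivable (fun t => - 2 * expR (- (2^-1 * t))) x 1.
  by move=> _; have [] := dF x.
rewrite /Rintegral /gamma_itv (continuous_FTC2 (gamma_itv_lt n)
  (within_continuous_gamma_itv _ n df) (derivable_gamma_itv_LRcontinuous _ n dF')).
  rewrite -EFinB/=.
  have h1 : expR (- (2^-1 * n.+2%:R^-1)) <= 1 :> R.
    by rewrite expR_le1 oppr_le0.
  by have := expR_ge0 (- (2^-1 * n.+2%:R) : R); lra.
by move=> x _; rewrite derive1E; have [_] := dF x.
Qed.

Lemma gamma_integrand_integrable z n :
  mu.-integrable (gamma_itv n) (EFin \o gamma_integrand z).
Proof. by apply: gamma_itv_integrable => x; exact: gamma_integrand_derivable. Qed.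

(** For an argument greater than 1 the integrand has no singularity at 0, and
    t ^ z = O(exp (t / 2)) bounds it by a multiple of exp (- t / 2). *)
Lemma Gamma_truncS_bounded z : 0 < z ->
  exists M, forall n, Gamma_trunc n (z + 1) <= M.
Proof.
move=> z0; exists ((z / 2^-1) `^ z * 2) => n.
have df (x : R) : 0 < x -> derivable (fun t => expR (- (2^-1 * t))) x 1.
  by move=> _; have [] := is_derive_expRN x 2^-1.
apply: (@le_trans _ _ (\int[mu]_(t in gamma_itv n)
    ((z / 2^-1) `^ z * expR (- (2^-1 * t))))).
  apply: le_Rintegral.
  - exact: gamma_itv_measurable.
  - exact: gamma_integrand_integrable.
  - by apply: gamma_itv_integrable => x x0; apply: derivableM => //; exact: df.
  move=> t /gamma_itv_gt0 t0; rewrite /gamma_integrand addrK.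
  have h2 : 0 < 2^-1 :> R by [].
  have := powR_le_expR 2^-1 z t h2 z0 (ltW t0).
  rewrite -(ler_pM2r (expR_gt0 (- t))) => /le_trans; apply.
  rewrite -mulrA -expRD.
  by have -> : 2^-1 * t - t = - (2^-1 * t) by field.
rewrite RintegralZl//; last 2 first.
- exact: gamma_itv_measurable.
- exact: gamma_itv_integrable.
by rewrite ler_wpM2l ?powR_ge0// integral_expRN_half_le.
Qed.

Definition Gamma_boundary z (n : nat) : R :=
  n.+2%:R^-1 `^ z * expR (- n.+2%:R^-1) - n.+2%:R `^ z * expR (- n.+2%:R).

Lemma cvg_Gamma_boundary z : 0 < z -> Gamma_boundary z n @[n --> \oo] --> 0.
Proof.
move=> z0.
have hinv : (n.+2%:R^-1 : R) @[n --> \oo] --> (0 : R).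
  have := @cvg_harmonic R; rewrite -cvg_shiftS; exact.
rewrite -[0]subr0; apply: cvgB.
  have h1 : (n.+2%:R^-1 `^ z : R) @[n --> \oo] --> (0 : R).
    by apply: ((cvg_at_rightP _ _ _).1 (powR_cvg0 z0)); split.
  apply: (squeeze_cvgr _ (cvg_cst 0) h1); near=> n.
  rewrite mulr_ge0 ?powR_ge0 ?expR_ge0//=.
  by rewrite ler_piMr ?powR_ge0// expR_le1 oppr_le0.
have h1 : (((z + 1) / 1) `^ (z + 1) * n.+2%:R^-1) @[n --> \oo] --> (0 : R).
  by rewrite -[0](mulr0 (((z + 1) / 1) `^ (z + 1))); apply: cvgMr.
apply: (squeeze_cvgr _ (cvg_cst 0) h1); near=> n.
rewrite mulr_ge0 ?powR_ge0 ?expR_ge0//=.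
have z1 : 0 < z + 1 by rewrite addr_gt0.
have n0 : 0 < n.+2%:R :> R by [].
rewrite ler_pdivlMr//.
have := powR_le_expR 1 (z + 1) n.+2%:R ltr01 z1 (ltW n0).
rewrite -(ler_pM2r (expR_gt0 (- n.+2%:R))) mul1r -[leRHS]mulrA -expRD subrr expR0 mulr1.
apply: le_trans; rewrite powRD ?powRr1//; last by rewrite implybE gt_eqF ?orbT.
by rewrite mulrAC.
Unshelve. all: by end_near. Qed.

(** The singularity at 0 for z < 1 is dealt with by the recurrence: z times the
    truncated integral at z differs from the one at z + 1 by bounded boundary
    terms. *)
Lemma Gamma_trunc_bounded z : 0 < z ->
  exists M, forall n, Gamma_trunc n z <= M.
Proof.
move=> z0; have [M HM] := Gamma_truncS_bounded z z0.
have /cvg_seq_bounded [N [_ HN]] : cvgn (Gamma_boundary z).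
  by apply/cvg_ex; exists 0; exact: cvg_Gamma_boundary.
exists ((M + (N + 1)) / z) => n; rewrite ler_pdivlMr//.
have := Gamma_trunc_recurrence n z; rewrite -/(Gamma_boundary z n).
have NN : N < N + 1 by rewrite ltrDl.
have /= := HN _ NN n I; rewrite ler_norml => /andP[h1 h2] h3.
move: (HM n) h1 h2; rewrite h3.
by generalize (Gamma_trunc n z) (Gamma_boundary z n) => G B; lra.
Qed.

(** Monotone convergence gives the limit in the extended reals; boundedness
    makes it finite, so that it is the real-valued integral defining Gamma. *)
Lemma Gamma_trunc_cvg z : 0 < z -> Gamma_trunc n z @[n --> \oo] --> Gamma z.
Proof.
move=> z0; have [M HM] := Gamma_trunc_bounded z z0.
pose I n := (\int[mu]_(t in gamma_itv n) (gamma_integrand z t)%:E)%E.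
have IE n : I n = (Gamma_trunc n z)%:E.
  rewrite /Gamma_trunc /Rintegral fineK//; apply: integrable_fin_num.
    exact: gamma_itv_measurable.
  exact: gamma_integrand_integrable.
have cI : I n @[n --> \oo] -->
    (\int[mu]_(t in `]0%R, +oo[) (gamma_integrand z t)%:E)%E.
  rewrite -gamma_itv_bigcup.
  apply: ge0_nondecreasing_set_cvg_integral.
  - exact: gamma_itv_nd.
  - exact: gamma_itv_measurable.
  - by move=> n; have /integrableP[] := gamma_integrand_integrable z n.
  - by move=> n x _; rewrite lee_fin gamma_integrand_ge0.
set J := (X in _ --> X) in cI.
have Jfin : J \is a fin_num.
  apply/fin_real/andP; split.
    rewrite (lt_le_trans (ltNyr 0))//; apply: integral_ge0 => x _.
    by rewrite lee_fin gamma_integrand_ge0.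
  apply: le_lt_trans (ltry M); apply: cvge_le cI; near=> n.
  by rewrite -/(I n) IE lee_fin.
have -> : Gamma z = fine J by [].
move: cI; rewrite -(fineK Jfin) => /fine_cvg.
apply: cvg_trans; apply: near_eq_cvg; near=> n.
by rewrite /= -/(I n) IE.
Unshelve. all: by end_near. Qed.

Lemma Gamma_addr1 z : 0 < z -> Gamma (z + 1) = z * Gamma z.
Proof.
move=> z0; have z1 : 0 < z + 1 by rewrite addr_gt0.
apply: (cvg_unique _ (Gamma_trunc_cvg _ z1)) => //.
have h : (z * Gamma_trunc n z + Gamma_boundary z n) @[n --> \oo] -->
    z * Gamma z + 0.
  apply: cvgD; last exact: cvg_Gamma_boundary.
  by apply: cvgMr; exact: Gamma_trunc_cvg.
rewrite addr0 in h; apply: cvg_trans h; apply: near_eq_cvg; near=> n.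
by rewrite Gamma_trunc_recurrence.
Unshelve. all: by end_near. Qed.

Lemma Gamma_trunc_nd z : nondecreasing_seq (Gamma_trunc ^~ z).
Proof.
apply/nondecreasing_seqP => n; rewrite /Gamma_trunc /Rintegral.
apply: fine_le.
- apply: integrable_fin_num; first exact: gamma_itv_measurable.
  exact: gamma_integrand_integrable.
- apply: integrable_fin_num; first exact: gamma_itv_measurable.
  exact: gamma_integrand_integrable.
apply: ge0_subset_integral => //=; first exact: gamma_itv_measurable.
- exact: gamma_itv_measurable.
- by have /integrableP[] := gamma_integrand_integrable z n.+1.
- by move=> x _; rewrite lee_fin gamma_integrand_ge0.
- by have := gamma_itv_nd _ _ (leqnSn n); rewrite subsetEset.
Qed.

Lemma Gamma_gt0 z : 0 < z -> 0 < Gamma z.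
Proof.
move=> z0; apply: (@lt_le_trans _ _ (Gamma_trunc 0 z)); last first.
  rewrite -(cvg_lim _ (Gamma_trunc_cvg _ z0))//.
  apply: nondecreasing_cvgn_le; first exact: Gamma_trunc_nd.
  by apply/cvg_ex; exists (Gamma z); exact: Gamma_trunc_cvg.
have [c cI cmin] := @EVT_min R (gamma_integrand z) _ _ (ltW (gamma_itv_lt 0))
  (within_continuous_gamma_itv _ 0 (gamma_integrand_derivable z)).
apply: (@lt_le_trans _ _ (\int[mu]_(t in gamma_itv 0) gamma_integrand z c)).
  rewrite Rintegral_cst; last exact: gamma_itv_measurable.
  apply: mulr_gt0.
    by rewrite mulr_gt0 ?expR_gt0 ?powR_gt0// (gamma_itv_gt0 0).
  have mE : (@lebesgue_measure R) (gamma_itv 0) = (2 - 2^-1)%:E.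
    by rewrite /gamma_itv lebesgue_measure_itv/= lte_fin gamma_itv_lt.
  by rewrite [X in fine X]mE/= subr_gt0 gamma_itv_lt.
apply: le_Rintegral.
- exact: gamma_itv_measurable.
- by apply: gamma_itv_integrable.
- exact: gamma_integrand_integrable.
- by move=> t tI; apply: cmin.
Qed.

(** Young's inequality for the product of u and 1 with exponents c + 1 and
    (c + 1) / c. *)
Lemma young_powR (c u : R) : 0 < c -> 0 <= u ->
  (c + 1) * u <= c + u `^ (c + 1).
Proof.
move=> c0 u0; have c1 : 0 < c + 1 by rewrite addr_gt0.
have q0 : 0 < (c + 1) / c by rewrite divr_gt0.
have e : (c + 1)^-1 + ((c + 1) / c)^-1 = 1.
  by field; rewrite !gt_eqF.
have := conjugate_powR u0 ler01 c1 q0 e.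
rewrite mulr1 powR1 /= -(ler_pM2l c1) => /le_trans; apply.
by rewrite le_eqVlt; apply/orP; left; apply/eqP; field; rewrite !gt_eqF.
Qed.

(** Linear inequalities between powers of t integrate to inequalities between
    values of Gamma; passing through the truncated integrals leaves no
    integrability to check beyond continuity on a compact interval. *)
Lemma Gamma_le_comb (z1 z2 z3 c1 c2 c3 : R) :
  0 < z1 -> 0 < z2 -> 0 < z3 ->
  (forall t, 0 < t ->
    c1 * t `^ (z1 - 1) <= c2 * t `^ (z2 - 1) + c3 * t `^ (z3 - 1)) ->
  c1 * Gamma z1 <= c2 * Gamma z2 + c3 * Gamma z3.
Proof.
move=> z10 z20 z30 H.
have l : c1 * Gamma_trunc n z1 @[n --> \oo] --> c1 * Gamma z1.
  by apply: cvgMr; exact: Gamma_trunc_cvg.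
have r : (c2 * Gamma_trunc n z2 + c3 * Gamma_trunc n z3) @[n --> \oo] -->
    c2 * Gamma z2 + c3 * Gamma z3.
  by apply: cvgD; apply: cvgMr; exact: Gamma_trunc_cvg.
apply: ler_cvg_to l r _; near=> n.
have mI := gamma_itv_measurable n.
have gi z := gamma_integrand_integrable z n.
have gM c z : mu.-integrable (gamma_itv n)
    (EFin \o (fun t => c * gamma_integrand z t)).
  apply: gamma_itv_integrable => x x0; apply: derivableM => //.
  exact: gamma_integrand_derivable.
rewrite /Gamma_trunc -!RintegralZl// -RintegralD//.
apply: le_Rintegral => //.
  apply: gamma_itv_integrable => x x0; apply: derivableD; apply: derivableM => //;
  exact: gamma_integrand_derivable.
move=> t /gamma_itv_gt0 t0; rewrite /gamma_integrand !mulrA -mulrDl.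
by rewrite ler_wpM2r ?expR_ge0// H.
Unshelve. all: by end_near. Qed.

(** Young's inequality at u = (z + c) / t, integrated, bounds
    (c + 1) Gamma (z + c) by a combination of Gamma (z + c + 1), which is
    (z + c) Gamma (z + c), and of Gamma z.  The scale z + c is the one for which
    c copies of Gamma (z + c) cancel. *)
Lemma Gamma_add_le (z c : R) : 0 < z -> 0 < c ->
  Gamma (z + c) <= (z + c) `^ c * Gamma z.
Proof.
move=> z0 c0; have l0 : 0 < z + c by rewrite addr_gt0.
have l1 : 0 < z + c + 1 by rewrite addr_gt0.
suff : (c + 1) * (z + c) * Gamma (z + c) <=
    c * Gamma (z + c + 1) + (z + c) `^ (c + 1) * Gamma z.
  rewrite Gamma_addr1// powRD ?(powRr1 (ltW l0))//; last first.
    by rewrite implybE (gt_eqF l0) orbT.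
  generalize (Gamma (z + c)) (Gamma z) => G1 G0 h; rewrite -(ler_pM2l l0).
  rewrite -subr_ge0; move: h; rewrite -subr_ge0.
  by congr (_ <= _); ring.
apply: Gamma_le_comb => // t t0.
have u0 : 0 <= (z + c) / t by rewrite divr_ge0 ?ltW.
have := young_powR c _ c0 u0.
rewrite -(ler_pM2r (powR_gt0 (z + c) t0)) => h.
have e1 : t `^ (z + c) = t `^ (z + c - 1) * t.
  rewrite -[X in _ * X]powRr1 ?ltW// -powRD ?subrK//.
  by rewrite implybE (gt_eqF t0) orbT.
have e2 : t `^ (z + c) = t `^ (z - 1) * t `^ (c + 1).
  rewrite -powRD; last by rewrite implybE (gt_eqF t0) orbT.
  by congr (_ `^ _); ring.
have eL : (c + 1) * ((z + c) / t) * t `^ (z + c) =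
    (c + 1) * (z + c) * t `^ (z + c - 1).
  by rewrite e1; field; rewrite gt_eqF.
have eR : (c + ((z + c) / t) `^ (c + 1)) * t `^ (z + c) =
    c * t `^ (z + c) + (z + c) `^ (c + 1) * t `^ (z - 1).
  rewrite mulrDl powRM ?ltW ?invr_gt0// -(powR_inv1 (ltW t0)) -powRrM mulN1r.
  by rewrite powRN {2}e2; field; rewrite gt_eqF// powR_gt0.
by rewrite addrK -eL -eR.
Qed.

(** As for the upper bound, now with u = t / (z - 1): the term in Gamma (z - 1)
    is c Gamma z by the recurrence and cancels. *)
Lemma Gamma_add_ge (z c : R) : 1 < z -> 0 < c ->
  (z - 1) `^ c * Gamma z <= Gamma (z + c).
Proof.
move=> z1 c0; have z0 : 0 < z by rewrite (lt_trans _ z1).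
have y0 : 0 < z - 1 by rewrite subr_gt0.
suff : (c + 1) * (z - 1) `^ c * Gamma z <=
    c * (z - 1) `^ (c + 1) * Gamma (z - 1) + 1 * Gamma (z + c).
  have := Gamma_addr1 _ y0; rewrite subrK.
  generalize (Gamma z) (Gamma (z - 1)) (Gamma (z + c)) => G0 G1 G2 ->.
  rewrite powRD ?(powRr1 (ltW y0))//; last by rewrite implybE (gt_eqF y0) orbT.
  move=> h; rewrite -subr_ge0; move: h; rewrite -subr_ge0.
  by congr (_ <= _); ring.
apply: Gamma_le_comb => //; first by rewrite addr_gt0.
move=> t t0.
have u0 : 0 <= t / (z - 1) by rewrite divr_ge0 ?ltW.
have := young_powR c _ c0 u0.
have w0 : 0 < (z - 1) `^ (c + 1) * t `^ (z - 1 - 1).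
  by rewrite mulr_gt0 ?powR_gt0.
rewrite -(ler_pM2r w0) => h.
have e1 : t `^ (z - 1) = t `^ (z - 1 - 1) * t.
  rewrite -[X in _ * X]powRr1 ?ltW// -powRD ?subrK//.
  by rewrite implybE (gt_eqF t0) orbT.
have e2 : t `^ (z + c - 1) = t `^ (z - 1 - 1) * t `^ (c + 1).
  rewrite -powRD; last by rewrite implybE (gt_eqF t0) orbT.
  by congr (_ `^ _); ring.
have e3 : (z - 1) `^ (c + 1) = (z - 1) `^ c * (z - 1).
  by rewrite powRD ?powRr1 ?ltW// implybE (gt_eqF y0) orbT.
have eL : (c + 1) * (t / (z - 1)) * ((z - 1) `^ (c + 1) * t `^ (z - 1 - 1)) =
    (c + 1) * (z - 1) `^ c * t `^ (z - 1).
  by rewrite e1 e3; field; rewrite gt_eqF.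
have eR : (c + (t / (z - 1)) `^ (c + 1)) *
      ((z - 1) `^ (c + 1) * t `^ (z - 1 - 1)) =
    c * (z - 1) `^ (c + 1) * t `^ (z - 1 - 1) + 1 * t `^ (z + c - 1).
  rewrite powRM ?ltW ?invr_gt0// -(powR_inv1 (ltW y0)) -powRrM mulN1r.
  by rewrite powRN e2; field; rewrite gt_eqF// powR_gt0.
by rewrite -eL -eR.
Qed.

End gamma.

(** * Sequences of the form exp (O(1/k)) *)

Section near_one.
Context {R : realType}.
Implicit Types (f g : nat -> R) (x : R).

Lemma expR_le_onem x : 0 <= x <= 2^-1 -> expR (- (2 * x)) <= 1 - x.
Proof.
move=> /andP[x0 x1]; rewrite expRN.
have h := expR_ge1Dx (2 * x).
rewrite (@le_trans _ _ (1 + 2 * x)^-1)//.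
  by rewrite lef_pV2 ?posrE ?expR_gt0//; lra.
rewrite -div1r ler_pdivrMr; last lra.
nra.
Qed.

(** The sequences exp (O(1/k)).  In contrast with 1 + O(1/k), the exponential form
    is manifestly stable under products and inverses. *)
Definition near_one f := exists M : R, \forall k \near \oo,
  expR (- (M / k%:R)) <= f k <= expR (M / k%:R).

Lemma near_one_eq f g : (forall k, (0 < k)%N -> f k = g k) ->
  near_one f -> near_one g.
Proof.
move=> fg [M H]; exists M; near=> k; rewrite -fg; last by near: k; exact: nbhs_infty_gt.
by near: k.
Unshelve. all: by end_near. Qed.

Lemma near_one1 : near_one (fun=> 1).
Proof.
by exists 0; near=> k; rewrite mul0r oppr0 expR0 lexx.
Unshelve. all: by end_near. Qed.

Lemma near_oneM f g : near_one f -> near_one g -> near_one (fun k => f k * g k).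
Proof.
move=> [M H] [N G]; exists (M + N); near=> k.
have /andP[h1 h2] : expR (- (M / k%:R)) <= f k <= expR (M / k%:R) by near: k.
have /andP[g1 g2] : expR (- (N / k%:R)) <= g k <= expR (N / k%:R) by near: k.
rewrite mulrDl opprD !expRD; apply/andP; split.
  by rewrite ler_pM ?expR_ge0.
by rewrite ler_pM// ?(le_trans _ h1) ?(le_trans _ g1) ?expR_ge0.
Unshelve. all: by end_near. Qed.

Lemma near_oneV f : near_one f -> near_one (fun k => (f k)^-1).
Proof.
move=> [M H]; exists M; near=> k.
have /andP[h1 h2] : expR (- (M / k%:R)) <= f k <= expR (M / k%:R) by near: k.
have f0 : 0 < f k by rewrite (lt_le_trans _ h1)// expR_gt0.
rewrite expRN lef_pV2 ?posrE ?expR_gt0// h2/=.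
by rewrite -[leRHS]invrK -expRN lef_pV2 ?posrE ?expR_gt0.
Unshelve. all: by end_near. Qed.

Lemma near_one_prod n (F : 'I_n -> nat -> R) :
  (forall i, near_one (F i)) -> near_one (fun k => \prod_(i < n) F i k).
Proof.
elim: n F => [|n IH] F HF.
  by apply: near_one_eq near_one1 => k _; rewrite big_ord0.
apply: (near_one_eq (fun k => F ord0 k * \prod_(i < n) F (lift ord0 i) k)).
  by move=> k _; rewrite big_ord_recl.
by apply: near_oneM => //; exact: IH.
Qed.

Lemma near_one_bigO f : (fun k => f k - 1) =O_\oo (fun k => k%:R^-1 : R) ->
  near_one f.
Proof.
move=> /eqO_exP[M M0 H]; exists (2 * M); near=> k.
have k0 : 0 < k%:R :> R by rewrite ltr0n; near: k; exact: nbhs_infty_gt.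
have kM : 2 * M <= k%:R by near: k; exact: nbhs_infty_ger.
have kV : `|k%:R^-1 : R| = k%:R^-1 by rewrite ger0_norm// invr_ge0.
have : `|f k - 1| <= M * `|k%:R^-1 : R| by near: k.
rewrite kV ler_norml => /andP[h1 h2].
have x0 : 0 <= M / k%:R by rewrite divr_ge0 ?ltW.
apply/andP; split.
  rewrite -mulrA; apply: le_trans (expR_le_onem _ _) _.
    by rewrite x0/= ler_pdivrMr//; lra.
  lra.
have := expR_ge1Dx (2 * M / k%:R); rewrite -mulrA; lra.
Unshelve. all: by end_near. Qed.

(** Divided by (c k) ^ c, the two bounds on Gamma (z + c) / Gamma z at
    z = c k + a become (1 - 1 / (c k)) ^ c and (1 + (a + c) / (c k)) ^ c at
    worst. *)
Lemma near_one_Gamma_ratio (c a : R) : 0 < c -> 0 < a ->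
  near_one (fun k => Gamma (c * k.+1%:R + a) / Gamma (c * k%:R + a)
    / (c * k%:R) `^ c).
Proof.
move=> c0 a0; exists (a + c + 2); near=> k.
have k0 : 0 < k%:R :> R by rewrite ltr0n; near: k; exact: nbhs_infty_gt.
have kM : 2 / c <= k%:R by near: k; exact: nbhs_infty_ger.
have ck : 0 < c * k%:R by rewrite mulr_gt0.
have -> : c * k.+1%:R + a = c * k%:R + a + c by rewrite -natr1; ring.
set z := c * k%:R + a.
have ck2 : 2 <= c * k%:R by rewrite mulrC -ler_pdivrMr.
have z1 : 1 < z by rewrite /z; lra.
have z0 : 0 < z by lra.
have G0 := Gamma_gt0 _ z0.
suff key (r : R) : (z - 1) `^ c <= r <= (z + c) `^ c ->
    expR (- ((a + c + 2) / k%:R)) <= r / (c * k%:R) `^ c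
      <= expR ((a + c + 2) / k%:R).
  apply: key; rewrite ler_pdivlMr// ler_pdivrMr//; apply/andP; split.
    exact: Gamma_add_ge.
  exact: Gamma_add_le.
move=> /andP[lo up].
apply/andP; split.
  apply: (@le_trans _ _ ((1 - (c * k%:R)^-1) `^ c)).
    apply: (@le_trans _ _ (expR (- (2 * (c * k%:R)^-1)) `^ c)).
      rewrite -expRM ler_expR mulNr lerN2.
      rewrite (_ : 2 / (c * k%:R) * c = 2 / k%:R); last by field; rewrite !gt_eqF.
      by rewrite ler_pM2r ?invr_gt0//; lra.
    have h : (c * k%:R)^-1 <= 2^-1 by rewrite lef_pV2 ?posrE.
    have h0 : 0 <= (c * k%:R)^-1 by rewrite invr_ge0 ltW.
    apply: ge0_ler_powR; rewrite ?nnegrE ?expR_ge0//; first exact: ltW.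
      lra.
    by apply: expR_le_onem; rewrite h0 h.
  apply: (@le_trans _ _ ((z - 1) `^ c / (c * k%:R) `^ c)).
    have h : (c * k%:R)^-1 <= 2^-1 by rewrite lef_pV2 ?posrE.
    rewrite ler_pdivlMr ?powR_gt0// -powRM ?(ltW ck)//; last lra.
    apply: ge0_ler_powR; rewrite ?nnegrE//; first exact: ltW.
    - rewrite mulrBl mul1r mulVf ?gt_eqF//; lra.
    - lra.
    - rewrite mulrBl mul1r mulVf ?gt_eqF// /z; lra.
  by rewrite ler_pM2r ?invr_gt0 ?powR_gt0.
apply: (@le_trans _ _ ((z + c) `^ c / (c * k%:R) `^ c)).
  by rewrite ler_pM2r ?invr_gt0 ?powR_gt0.
rewrite ler_pdivrMr ?powR_gt0//.
apply: (@le_trans _ _ ((expR ((a + c) / (c * k%:R)) * (c * k%:R)) `^ c)).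
  apply: ge0_ler_powR; rewrite ?nnegrE//; first exact: ltW.
  - lra.
  - by rewrite mulr_ge0 ?expR_ge0 ?ltW.
  have := expR_ge1Dx ((a + c) / (c * k%:R)).
  rewrite -(ler_pM2r ck) => /(le_trans _); apply.
  by rewrite mulrDl mul1r divfK ?gt_eqF// /z; lra.
rewrite powRM ?expR_ge0 ?(ltW ck)// ler_pM2r ?powR_gt0// -expRM ler_expR.
rewrite (_ : (a + c) / (c * k%:R) * c = (a + c) / k%:R); last first.
  by field; rewrite !gt_eqF.
by rewrite ler_pM2r ?invr_gt0//; lra.
Unshelve. all: by end_near. Qed.

(** A relative error O(1/k) is a shift of k by a constant, since
    (1 + D / k) ^ kappa >= 1 + D / k.  The shifted lower bound holds from k = 0 on,
    so the first summands need no separate treatment. *)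
Lemma near_one_shift (r : nat -> R) (kappa : nat) (E : R) :
  (0 < kappa)%N -> 0 < E -> (forall k, 0 < r k) ->
  near_one (fun k => r k * k%:R ^+ kappa / E) ->
  exists2 D : R, 0 < D &
    (forall k, E <= (k%:R + D) ^+ kappa * r k) /\
    (forall k, D < k%:R -> (k%:R - D) ^+ kappa * r k <= E).
Proof.
move=> kappa0 E0 r0 [M0 H].
pose M := `|M0|.
have M_ge0 : 0 <= M by exact: normr_ge0.
have [K _ HK] : \forall k \near \oo,
    [/\ (0 < k)%N, 2 * M <= k%:R,
        expR (- (M / k%:R)) <= r k * k%:R ^+ kappa / E &
        r k * k%:R ^+ kappa / E <= expR (M / k%:R)].
  near=> k.
  have k0 : (0 < k)%N by near: k; exact: nbhs_infty_gt.
  have /andP[h1 h2] : expR (- (M0 / k%:R)) <= r k * k%:R ^+ kappa / E <=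
      expR (M0 / k%:R) by near: k.
  have le : M0 / k%:R <= M / k%:R by rewrite ler_pM2r ?invr_gt0 ?ltr0n// ler_norm.
  split => //.
  - by near: k; exact: nbhs_infty_ger.
  - by apply: le_trans h1; rewrite ler_expR lerN2.
  - by apply: le_trans h2 _; rewrite ler_expR.
have S_ge0 : 0 <= \sum_(j < K) E / r j.
  by apply: sumr_ge0 => j _; rewrite divr_ge0 ?ltW.
set S := \sum_(j < K) E / r j in S_ge0.
have K_ge0 : 0 <= K%:R :> R by exact: ler0n.
(* 2 M dominates the relative error for large k; K makes k > D imply that k is
   large; S handles the finitely many k < K in the lower bound. *)
exists (2 * M + K%:R + S + 1); first lra.
set D := (2 * M + K%:R + S + 1).
have D1 : 1 <= D by rewrite /D; lra.
split=> k.
  have [Kk|kK] := leqP K k; last first.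
    rewrite -ler_pdivrMr//; apply: (@le_trans _ _ D).
      rewrite /D; apply: (@le_trans _ _ S); last by lra.
      rewrite /S (bigD1 (Ordinal kK))//= lerDl sumr_ge0// => j _.
      by rewrite divr_ge0 ?ltW.
    apply: (@le_trans _ _ (k%:R + D)); first by rewrite lerDr.
    by apply: ler_eXnr => //; have := ler0n R k; lra.
  have [k0 kM h _] := HK k Kk.
  have k0' : 0 < k%:R :> R by rewrite ltr0n.
  have kk0 : 0 < k%:R ^+ kappa :> R by rewrite exprn_gt0.
  have e1 : expR (M / k%:R) <= 1 + D / k%:R.
    have x0 : 0 <= M / k%:R by rewrite divr_ge0.
    have x1 : M / k%:R <= 2^-1 by rewrite ler_pdivrMr//; lra.
    have h1 := expR_ge1Dx (- (M / k%:R)).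
    have h2 : expR (M / k%:R) * (1 - M / k%:R) <= 1.
      rewrite -ler_pdivlMl ?expR_gt0// mulr1 -expRN; exact: h1.
    apply: (@le_trans _ _ (1 + 2 * (M / k%:R))).
      have := expR_ge0 (M / k%:R); nra.
    by rewrite lerD2l mulrA ler_pM2r ?invr_gt0// /D; lra.
  have e2 : (1 + D / k%:R) <= (1 + D / k%:R) ^+ kappa.
    by apply: ler_eXnr => //; rewrite lerDl divr_ge0// ltW//; lra.
  have -> : k%:R + D = k%:R * (1 + D / k%:R) by field; rewrite gt_eqF.
  rewrite exprMn.
  have hh : 1 <= (1 + D / k%:R) ^+ kappa * (r k * k%:R ^+ kappa / E).
    apply: (@le_trans _ _ (expR (M / k%:R) * expR (- (M / k%:R)))).
      by rewrite -expRD subrr expR0.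
    by rewrite ler_pM ?expR_ge0//; exact: le_trans e2.
  move: hh; rewrite mulrA ler_pdivlMr// mul1r => /le_trans; apply.
  by rewrite le_eqVlt; apply/orP; left; apply/eqP; ring.
move=> Dk.
have Kk : (K <= k)%N by rewrite -(ler_nat R); move: Dk; rewrite /D; lra.
have [k0 kM _ h] := HK k Kk.
have k0' : 0 < k%:R :> R by rewrite ltr0n.
have kk0 : 0 < k%:R ^+ kappa :> R by rewrite exprn_gt0.
have -> : k%:R - D = k%:R * (1 - D / k%:R) by field; rewrite gt_eqF.
have d1 : 0 <= 1 - D / k%:R by rewrite subr_ge0 ler_pdivrMr// mul1r ltW.
have d2 : 1 - D / k%:R <= expR (- (M / k%:R)).
  apply: le_trans (expR_ge1Dx _); rewrite lerD2l lerN2 ler_pM2r ?invr_gt0// /D.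
  lra.
have d3 : (1 - D / k%:R) ^+ kappa <= 1 - D / k%:R.
  apply: ler_iXnr => //; rewrite gerBl divr_ge0//; lra.
have rk : 0 <= r k * k%:R ^+ kappa / E by rewrite divr_ge0 ?mulr_ge0 ?ltW.
have hh : (1 - D / k%:R) ^+ kappa * (r k * k%:R ^+ kappa / E) <= 1.
  apply: (@le_trans _ _ (expR (- (M / k%:R)) * expR (M / k%:R))).
    by rewrite ler_pM ?exprn_ge0//; apply: le_trans d3 _.
  by rewrite -expRD addNr expR0.
move: hh; rewrite mulrA ler_pdivrMr// mul1r; apply: le_trans.
by rewrite exprMn le_eqVlt; apply/orP; left; apply/eqP; ring.
Unshelve. all: by end_near. Qed.

End near_one.

(** * Decay of the summands away from the peak *)

Section decay.
Context {R : realType}.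

Lemma nondecreasing_bounded_lim (u : nat -> R) (B : R) :
  nondecreasing_seq u -> (forall n, u n <= B) -> cvgn u /\ limn u <= B.
Proof.
move=> nd ub; have cu : cvgn u.
  apply: nondecreasing_is_cvgn => //; exists B => _ [n _ <-]; exact: ub.
by split => //; apply: limr_le => //; exact: nearW.
Qed.

(** The sum telescopes, t k.+1 being at most (t k - t k.+1) / eta. *)
Lemma geometric_tail_sum (t : nat -> R) (eta : R) (m : nat) :
  0 < eta -> (forall k, 0 <= t k) ->
  (forall k, (m <= k)%N -> (1 + eta) * t k.+1 <= t k) ->
  forall M, \sum_(m <= k < M) t k <= (1 + eta^-1) * t m.
Proof.
move=> eta0 t0 H M.
have i0 : 0 < eta^-1 by rewrite invr_gt0.
have [Mm|/ltnW mM] := leqP M m.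
  by rewrite big_geq// mulr_ge0//; lra.
suff : \sum_(m <= k < M) t k + (1 + eta^-1) * t M <= (1 + eta^-1) * t m.
  by apply: le_trans; rewrite lerDl mulr_ge0//; lra.
rewrite -(subnKC mM); elim: (M - m)%N => [|d IH].
  by rewrite addn0 big_geq// add0r.
apply: le_trans IH; rewrite addnS big_nat_recr ?leq_addr//=.
rewrite -addrA lerD2l.
have h := H (m + d)%N (leq_addr _ _).
move: h; rewrite -(ler_pM2l i0).
have -> : eta^-1 * ((1 + eta) * t (m + d).+1) = (1 + eta^-1) * t (m + d).+1.
  by field; rewrite gt_eqF.
lra.
Qed.

Lemma powers_coef_ge0 (c : nat -> R) (kappa : nat) :
  (forall k, 0 <= c k) -> forall n, 0 <= powers_coef c kappa n.
Proof. by move=> c0 n; rewrite /powers_coef; case: ifP. Qed.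

Lemma pseries_nd (a : nat -> R) (x : R) : (forall n, 0 <= a n) -> 0 <= x ->
  nondecreasing_seq (pseries a x).
Proof.
move=> a0 x0; apply/nondecreasing_seqP => n; rewrite /pseries /series/=.
by rewrite big_nat_recr//= lerDl mulr_ge0// exprn_ge0.
Qed.

Lemma pseries_powers_le (c : nat -> R) (kappa : nat) (x : R) (n : nat) :
  (0 < kappa)%N -> (forall k, 0 <= c k) -> 0 <= x ->
  pseries (powers_coef c kappa) x n <= \sum_(0 <= k < n) c k * x ^+ (kappa * k).
Proof.
move=> kappa0 c0 x0; rewrite -powers_coefE//.
by apply: pseries_nd => //; [exact: powers_coef_ge0 | rewrite leq_pmull].
Qed.

Lemma term_le_lim (c : nat -> R) (kappa : nat) (x : R) (k : nat) :
  (0 < kappa)%N -> (forall k, 0 <= c k) -> 0 <= x ->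
  cvgn (pseries (powers_coef c kappa) x) ->
  c k * x ^+ (kappa * k) <= limn (pseries (powers_coef c kappa) x).
Proof.
move=> kappa0 c0 x0 cv.
have nd := pseries_nd (powers_coef c kappa) x (powers_coef_ge0 c kappa c0) x0.
apply: le_trans (nondecreasing_cvgn_le nd cv (kappa * k.+1)%N).
rewrite powers_coefE// big_nat_recr//= lerDr.
by apply: sumr_ge0 => j _; rewrite mulr_ge0// exprn_ge0.
Qed.

(** Below the peak the ratio of consecutive summands is at least
    (e x / (k + D)) ^ kappa, hence at least 1 / (1 - eta), which is at least
    exp (eta). *)
Lemma ratio_lower (c : nat -> R) (kappa : nat) (e D x eta : R) (k : nat) :
  (0 < kappa)%N -> 0 < e -> 0 < D -> 0 < c k -> 0 < c k.+1 -> 0 < x -> 0 <= eta ->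
  e ^+ kappa * c k <= (k%:R + D) ^+ kappa * c k.+1 ->
  k%:R + D <= e * x * (1 - eta) ->
  c k * x ^+ (kappa * k) <= expR (- eta) * (c k.+1 * x ^+ (kappa * k.+1)).
Proof.
move=> kappa0 e0 D0 ck ck1 x0 eta0 lo hk.
have N0 : 0 < (e * x) ^+ kappa by rewrite exprn_gt0// mulr_gt0.
rewrite -(ler_pM2l N0).
have h1 : (k%:R + D) ^+ kappa <= (e * x) ^+ kappa * expR (- eta).
  apply: (@le_trans _ _ ((e * x * expR (- eta)) ^+ kappa)).
    apply: lerXn2r; rewrite ?nnegrE.
    - by rewrite addr_ge0// ltW.
    - by rewrite !mulr_ge0 ?expR_ge0// ltW.
    apply: le_trans hk _; rewrite ler_pM2l ?mulr_gt0//.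
    exact: expR_ge1Dx.
  rewrite exprMn ler_pM2l//; apply: ler_iXnr => //.
  by rewrite expR_le1 oppr_le0.
apply: (@le_trans _ _ ((k%:R + D) ^+ kappa * c k.+1 * x ^+ (kappa * k.+1))).
  rewrite exprMn mulnS exprD.
  rewrite [leLHS](_ : _ = e ^+ kappa * c k * (x ^+ kappa * x ^+ (kappa * k))).
    by rewrite ler_pM2r// mulr_gt0// exprn_gt0.
  ring.
rewrite -[leLHS]mulrA [leRHS]mulrA; apply: ler_wpM2r => //.
by rewrite mulr_ge0 ?exprn_ge0 ?ltW.
Qed.

Lemma ratio_upper (c : nat -> R) (kappa : nat) (e D x eta : R) (k : nat) :
  (0 < kappa)%N -> 0 < e -> 0 < c k -> 0 < c k.+1 -> 0 < x -> 0 <= eta ->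
  (k%:R - D) ^+ kappa * c k.+1 <= e ^+ kappa * c k ->
  e * x * (1 + eta) <= k%:R - D ->
  (1 + eta) * (c k.+1 * x ^+ (kappa * k.+1)) <= c k * x ^+ (kappa * k).
Proof.
move=> kappa0 e0 ck ck1 x0 eta0 hi hk.
have N0 : 0 < (e * x) ^+ kappa by rewrite exprn_gt0// mulr_gt0.
have w0 : 0 <= c k.+1 * x ^+ (kappa * k.+1) by rewrite mulr_ge0 ?exprn_ge0 ?ltW.
have exe : 0 <= e * x * (1 + eta) by rewrite mulr_ge0 ?addr_ge0// mulr_ge0// ltW.
rewrite -(ler_pM2l N0).
have h1 : (e * x) ^+ kappa * (1 + eta) <= (k%:R - D) ^+ kappa.
  apply: (@le_trans _ _ ((e * x * (1 + eta)) ^+ kappa)).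
    by rewrite [leRHS]exprMn ler_pM2l//; apply: ler_eXnr => //; rewrite lerDl.
  by apply: lerXn2r; rewrite ?nnegrE// (le_trans _ hk).
apply: (@le_trans _ _ ((k%:R - D) ^+ kappa * c k.+1 * x ^+ (kappa * k.+1))).
  by rewrite -[leRHS]mulrA [leLHS]mulrA; apply: ler_wpM2r.
rewrite exprMn mulnS exprD.
rewrite [leRHS](_ : _ = e ^+ kappa * c k * (x ^+ kappa * x ^+ (kappa * k))).
  by rewrite ler_pM2r// mulr_gt0// exprn_gt0.
ring.
Qed.

Lemma iter_decay (t : nat -> R) (q : R) (k L : nat) : 0 <= q ->
  (forall j, (j < L)%N -> t (k + j)%N <= q * t (k + j.+1)%N) ->
  t k <= q ^+ L * t (k + L)%N.
Proof.
move=> q0; elim: L => [|L IH] H; first by rewrite expr0 mul1r addn0.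
apply: le_trans (IH _) _; first by move=> j jL; apply: H; rewrite ltnS ltnW.
by rewrite exprSr -mulrA ler_wpM2l ?exprn_ge0// H.
Qed.

Lemma iter_decay_up (t : nat -> R) (q : R) (k L : nat) : 0 <= q ->
  (forall j, (j < L)%N -> t (k + j.+1)%N <= q * t (k + j)%N) ->
  t (k + L)%N <= q ^+ L * t k.
Proof.
move=> q0; elim: L => [|L IH] H; first by rewrite expr0 mul1r addn0.
apply: le_trans (H L _) _ => //.
rewrite exprS -mulrA ler_wpM2l// IH// => j jL; apply: H; rewrite ltnS ltnW//.
Qed.

Lemma expR_half_le (eta : R) : 0 <= eta <= 1 -> expR (eta / 2) <= 1 + eta.
Proof.
move=> /andP[h0 h1].
have h2 := expR_ge1Dx (- (eta / 2)).
have h3 : expR (eta / 2) * (1 - eta / 2) <= 1.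
  by rewrite -ler_pdivlMl ?expR_gt0// mulr1 -expRN.
have := expR_ge0 (eta / 2); nra.
Qed.

(** From relative distance 2 eta to relative distance eta below the peak there
    are about e x eta indices, each contributing a factor exp (- eta); the
    summand reached is at most the whole sum. *)
Lemma lower_tail_term (c : nat -> R) (kappa : nat) (e D x eta : R) (k : nat) :
  (0 < kappa)%N -> 0 < e -> 0 < D -> (forall k, 0 < c k) -> 0 < x ->
  0 <= eta <= 1 ->
  (forall k, e ^+ kappa * c k <= (k%:R + D) ^+ kappa * c k.+1) ->
  D <= e * x * eta ->
  k%:R <= e * x * (1 - 2 * eta) ->
  cvgn (pseries (powers_coef c kappa) x) ->
  c k * x ^+ (kappa * k) <=
    expR (D + 1) * expR (- (e * x * eta ^+ 2)) *
    limn (pseries (powers_coef c kappa) x).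
Proof.
move=> kappa0 e0 D0 c0 x0 /andP[eta0 eta1] lo hD hk cv.
have c0' j : 0 <= c j by rewrite ltW.
pose L := Num.truncn (e * x * eta - D).
have L1 : L%:R <= e * x * eta - D by rewrite /L truncn_le subr_ge0.
have L2 : e * x * eta - D - 1 <= L%:R.
  by have := truncnS_gt (e * x * eta - D); rewrite -/L -natr1; lra.
have := @iter_decay (fun j => c j * x ^+ (kappa * j)) (expR (- eta)) k L (expR_ge0 _).
have h j : (j < L)%N -> c (k + j)%N * x ^+ (kappa * (k + j)) <=
    expR (- eta) * (c (k + j.+1)%N * x ^+ (kappa * (k + j.+1))).
  move=> jL; rewrite addnS; apply: (@ratio_lower c kappa e D) => //.
  have : j%:R <= L%:R :> R by rewrite ler_nat ltnW.
  rewrite natrD; lra.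
move=> /(_ h) /le_trans; apply.
have tl := term_le_lim c kappa x (k + L) kappa0 c0' (ltW x0) cv.
apply: ler_pM; [by rewrite exprn_ge0// expR_ge0
  |by rewrite mulr_ge0// exprn_ge0// ltW| |exact: tl].
rewrite -expRM_natl -expRD ler_expR.
nra.
Qed.

(** The geometric series bounds the tail by its first summand, and that summand,
    at relative distance 2 eta above the peak, is compared with the one at
    relative distance eta as below the peak.  Here 1 + eta >= exp (eta / 2)
    replaces the inequality 1 - eta <= exp (- eta), whence the exponent is
    halved. *)
Lemma upper_tail_sum (c : nat -> R) (kappa : nat) (e D x eta : R) (m : nat) (M : nat) :
  (0 < kappa)%N -> 0 < e -> 0 < D -> (forall k, 0 < c k) -> 0 < x ->
  0 < eta <= 1 ->
  (forall k, D < k%:R -> (k%:R - D) ^+ kappa * c k.+1 <= e ^+ kappa * c k) ->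
  D + 3 <= e * x * eta ->
  e * x * (1 + 2 * eta) - 2 <= m%:R ->
  cvgn (pseries (powers_coef c kappa) x) ->
  \sum_(m <= k < M) c k * x ^+ (kappa * k) <=
    (1 + eta^-1) * (expR (D + 3) * expR (- (e * x * eta ^+ 2 / 2))) *
    limn (pseries (powers_coef c kappa) x).
Proof.
move=> kappa0 e0 D0 c0 x0 /andP[eta0 eta1] hi hD hm cv.
have c0' j : 0 <= c j by rewrite ltW.
have ex0 : 0 < e * x by rewrite mulr_gt0.
have eta0' : 0 <= eta by rewrite ltW.
pose t j := c j * x ^+ (kappa * j).
have t0 j : 0 <= t j by rewrite /t mulr_ge0// exprn_ge0// ltW.
have step j : e * x * (1 + eta) + D <= j%:R -> (1 + eta) * t j.+1 <= t j.
  move=> hj; apply: (@ratio_upper c kappa e D) => //; last lra.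
  by apply: hi; nra.
have i0 : 0 < eta^-1 by rewrite invr_gt0.
have /le_trans : \sum_(m <= k < M) t k <= (1 + eta^-1) * t m.
  apply: geometric_tail_sum => // k mk; apply: step.
  have : m%:R <= k%:R :> R by rewrite ler_nat.
  nra.
apply.
rewrite -[leRHS]mulrA ler_pM2l; last lra.
pose p := (Num.truncn (e * x * (1 + eta) + D)).+1.
have p1 : e * x * (1 + eta) + D <= p%:R by rewrite ltW// truncnS_gt.
have p2 : p%:R <= e * x * (1 + eta) + D + 1.
  rewrite /p -natr1 lerD2r truncn_le; nra.
have pm : (p <= m)%N by rewrite -(ler_nat R); nra.
pose L := (m - p)%N.
have LE : L%:R = m%:R - p%:R :> R by rewrite /L natrB.
rewrite -(subnKC pm) -/L.
have := @iter_decay_up t (expR (- (eta / 2))) p L (expR_ge0 _).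
have h j : (j < L)%N -> t (p + j.+1)%N <= expR (- (eta / 2)) * t (p + j)%N.
  move=> jL; rewrite expRN mulrC ler_pdivlMr ?expR_gt0// mulrC addnS.
  apply: (@le_trans _ _ ((1 + eta) * t (p + j).+1)).
    by rewrite ler_wpM2r// expR_half_le// eta0'.
  by apply: step; rewrite natrD; have := ler0n R j; lra.
move=> /(_ h) /le_trans; apply.
have tl := term_le_lim c kappa x p kappa0 c0' (ltW x0) cv.
apply: ler_pM; [by rewrite exprn_ge0// expR_ge0|exact: t0| |exact: tl].
rewrite -expRM_natl -expRD ler_expR LE.
nra.
Qed.

(** Beyond 2 e x + D the summands are at least halved at each step. *)
Lemma powers_coef_cvg (c : nat -> R) (kappa : nat) (e D x : R) :
  (0 < kappa)%N -> 0 < e -> 0 < D -> (forall k, 0 < c k) -> 0 < x ->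
  (forall k, D < k%:R -> (k%:R - D) ^+ kappa * c k.+1 <= e ^+ kappa * c k) ->
  cvgn (pseries (powers_coef c kappa) x).
Proof.
move=> kappa0 e0 D0 c0 x0 hi.
have c0' j : 0 <= c j by rewrite ltW.
pose t j := c j * x ^+ (kappa * j).
have t0 j : 0 <= t j by rewrite /t mulr_ge0// exprn_ge0// ltW.
have ex0 : 0 < e * x by rewrite mulr_gt0.
pose m := (Num.truncn (2 * (e * x) + D)).+1.
have hm : 2 * (e * x) + D <= m%:R by rewrite ltW// truncnS_gt.
have [] // := nondecreasing_bounded_lim (pseries (powers_coef c kappa) x)
  (\sum_(0 <= k < m) t k + (1 + 1^-1) * t m).
  by apply: pseries_nd; [exact: powers_coef_ge0 | exact: ltW].
move=> n; apply: le_trans (pseries_powers_le _ _ _ _ kappa0 c0' (ltW x0)) _.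
have gts : \sum_(m <= k < m + n) t k <= (1 + 1^-1) * t m.
  apply: geometric_tail_sum => // k mk.
  have mk' : m%:R <= k%:R :> R by rewrite ler_nat.
  apply: (@ratio_upper c kappa e D) => //; last lra.
  by apply: hi; lra.
apply: (@le_trans _ _ (\sum_(0 <= k < m + n) t k)).
  rewrite [leRHS](@big_cat_nat _ _ _ n)//= ?leq_addl// lerDl.
  by apply: sumr_ge0.
by rewrite (@big_cat_nat _ _ _ m)//= ?leq_addr// lerD2l.
Qed.

End decay.

(** * From bounds on ratios to exponential concentration *)

Section concentration.
Context {R : realType}.

Lemma lower_sum_le (a : nat -> R) (x Y Y' B : R) :
  0 <= B -> 0 <= Y' -> Y <= Y' ->
  (forall n, n%:R <= Y -> a n * x ^+ n <= B) ->
  lower_sum a (Num.floor Y) x <= (Y' + 1) * B.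
Proof.
move=> B0 Y0 YY H; rewrite /lower_sum.
have [Yn|Yp] := ltP (Num.floor Y) 0.
  rewrite big_pred0; first by rewrite mulr_ge0//; lra.
  by move=> n; apply/negbTE; rewrite -ltNge (lt_le_trans Yn).
set m := `|Num.floor Y|%N.
apply: (@le_trans _ _ (\sum_(0 <= n < m.+1) B)).
  rewrite big_mkcond/=; apply: ler_sum => n _; case: ifP => // hn.
  by apply: H; rewrite floor_ge_int in hn.
rewrite sumr_const_nat subn0 -[leLHS]mulr_natl ler_wpM2r// -natr1 lerD2r.
apply: le_trans YY; rewrite -[m%:R]/((m : int)%:~R) /m gez0_abs//.
exact: floor_le.
Qed.

(** The condition on the powers of x is moved into the coefficients c, so that
    the reindexing of partial sums by k applies. *)
Lemma upper_partial_sum_le (c : nat -> R) (kappa : nat) (m : int) (m' n : nat)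
    (x : R) :
  (0 < kappa)%N -> (forall k, 0 <= c k) -> 0 <= x ->
  (forall k, m <= (kappa * k)%N%:Z -> (m' <= k)%N) ->
  \sum_(0 <= i < n | m <= i%:Z) powers_coef c kappa i * x ^+ i <=
  \sum_(m' <= k < m' + n) c k * x ^+ (kappa * k).
Proof.
move=> kappa0 c0 x0 H.
pose c' k := if m <= (kappa * k)%N%:Z then c k else 0.
have c'0 k : 0 <= c' k by rewrite /c'; case: ifP.
have := pseries_powers_le c' kappa x n kappa0 c'0 x0.
have -> : pseries (powers_coef c' kappa) x n =
    \sum_(0 <= i < n | m <= i%:Z) powers_coef c kappa i * x ^+ i.
  rewrite /pseries /series/= [RHS]big_mkcond/=; apply: eq_bigr => i _.
  rewrite /powers_coef; case: ifP => [/dvdnP[k ->]|_]; last first.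
    by rewrite mul0r if_same.
  rewrite mulnK// /c' mulnC; case: ifP => // _.
  by rewrite mul0r.
move=> /le_trans; apply.
apply: (@le_trans _ _ (\sum_(0 <= k < m' + n) c' k * x ^+ (kappa * k))).
  rewrite [leRHS](@big_cat_nat _ _ _ n)//= ?leq_addl// lerDl.
  by apply: sumr_ge0 => i _; rewrite mulr_ge0// exprn_ge0.
rewrite (@big_cat_nat _ _ _ m')//= ?leq_addr// big_nat_cond big1 ?add0r.
  apply: ler_sum => i _; rewrite ler_wpM2r ?exprn_ge0// /c'.
  by case: ifP.
move=> i /andP[/andP[_ im] _]; rewrite /c'; case: ifP; last by rewrite mul0r.
by move=> /H; rewrite leqNgt im.
Qed.

Lemma upper_sum_le (c : nat -> R) (kappa : nat) (m : int) (m' : nat)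
    (x B : R) :
  (0 < kappa)%N -> (forall k, 0 <= c k) -> 0 <= x ->
  (forall k, m <= (kappa * k)%N%:Z -> (m' <= k)%N) ->
  (forall M, \sum_(m' <= k < M) c k * x ^+ (kappa * k) <= B) ->
  0 <= upper_sum (powers_coef c kappa) m x <= B.
Proof.
move=> kappa0 c0 x0 H HB.
pose u n := \sum_(0 <= i < n | m <= i%:Z) powers_coef c kappa i * x ^+ i.
have nd : nondecreasing_seq u.
  apply/nondecreasing_seqP => n; rewrite /u big_mkcond [leRHS]big_mkcond/=.
  rewrite big_nat_recr//= lerDl; case: ifP => // _.
  by rewrite mulr_ge0 ?exprn_ge0// powers_coef_ge0.
have [cu lu] : cvgn u /\ limn u <= B.
  apply: nondecreasing_bounded_lim => // n; apply: le_trans (HB (m' + n)%N).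
  exact: upper_partial_sum_le.
rewrite -/u in lu *; rewrite lu andbT.
apply: le_trans (nondecreasing_cvgn_le nd cu 0).
by rewrite /u big_geq.
Qed.

(** With y ^ 4 in the role of x: half of the exponent e * sqrt x / 2 absorbs a
    factor x. *)
Lemma le_expR_quarter (e y : R) : 0 < e -> 0 <= y ->
  y ^+ 4 * expR (- (e * y ^+ 2 / 2)) <=
  (8 / e) ^+ 2 * expR (- (e / 4) * y ^+ 2).
Proof.
move=> e0 y0.
have e4 : 0 < e / 4 by rewrite divr_gt0.
have y2 : 0 <= y ^+ 2 by rewrite exprn_ge0.
have := powR_le_expR (e / 4) 2 (y ^+ 2) e4 (ltr0n _ 2) y2.
have q0 : 0 <= 2 / (e / 4) by rewrite divr_ge0// ltW.
rewrite !powR_mulrn// -exprM.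
rewrite -(ler_pM2r (expR_gt0 (- (e * y ^+ 2 / 2)))) => /le_trans; apply.
rewrite -[leLHS]mulrA -expRD.
rewrite (_ : e / 4 * y ^+ 2 - e * y ^+ 2 / 2 = - (e / 4) * y ^+ 2); last by field.
by rewrite (_ : 2 / (e / 4) = 8 / e)//; field; rewrite gt_eqF.
Qed.

(** The peak is at k = e x, that is at n = kappa e x. *)
Lemma concentrate_of_ratio (c : nat -> R) (kappa : nat) (e D : R) :
  (0 < kappa)%N -> 0 < e -> 0 < D -> (forall k, 0 < c k) ->
  (forall k, e ^+ kappa * c k <= (k%:R + D) ^+ kappa * c k.+1) ->
  (forall k, D < k%:R -> (k%:R - D) ^+ kappa * c k.+1 <= e ^+ kappa * c k) ->
  concentrate_exponentially (powers_coef c kappa) ((kappa%:R * e) *: 'X).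
Proof.
move=> kappa0 e0 D0 c0 lo hi.
have c0' j : 0 <= c j by rewrite ltW.
have kR : 1 <= kappa%:R :> R by rewrite ler1n.
have cv x : 0 < x -> cvgn (pseries (powers_coef c kappa) x).
  by move=> x0; exact: (powers_coef_cvg c kappa e D x).
split.
- by split => //; exact: powers_coef_ge0.
- by exists 0%N; rewrite /powers_coef dvdn0 div0n gt_eqF.
- by rewrite lead_coefZ lead_coefX mulr1 mulr_gt0// ltr0n.
(* The window eta = x ^ (- 1/4) makes e x eta ^ 2 = e * sqrt x.  The tails are
   O(x exp (- e * sqrt x / 2)), and the factor x costs another half of the
   exponent. *)
exists 2, 4^-1, (e / 4), 2^-1.
split; rewrite ?invr_gt0 ?divr_gt0//.
(* In terms of y = x ^ (1/4) all quantities are polynomials in y and 1 / y. *)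
pose Y0 : R := 1 + (D + 3) / e.
have big : \forall x \near +oo, exists2 y : R, Y0 <= y &
    [/\ 0 < x, x = y ^+ 4, x `^ (- 4^-1) = y^-1 & x `^ 2^-1 = y ^+ 2].
  near=> x.
  have xY : Y0 ^+ 4 <= x by near: x; apply: nbhs_pinfty_ge; exact: num_real.
  have Y00 : 0 < Y0 by rewrite /Y0 addr_gt0// divr_gt0//; lra.
  have x0 : 0 < x by rewrite (lt_le_trans _ xY)// exprn_gt0.
  exists (x `^ 4^-1).
    rewrite -[leLHS](_ : (Y0 ^+ 4) `^ 4^-1 = Y0).
      apply: ge0_ler_powR; rewrite ?nnegrE ?exprn_ge0 ?invr_ge0 ?ler0n//; exact: ltW.
    by rewrite -powR_mulrn ?ltW// -powRrM mulfV// powRr1// ltW.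
  split => //.
  - by rewrite -powR_mulrn ?powR_ge0// -powRrM mulVf// powRr1// ltW.
  - by rewrite powRN.
  - by rewrite -powR_mulrn ?powR_ge0// -powRrM; congr (_ `^ _); field.
have fE x : ((kappa%:R * e) *: (@polyX R)).[x] = kappa%:R * e * x.
  by rewrite hornerZ hornerX.
have ke0 : 0 < kappa%:R * e by rewrite mulr_gt0// ltr0n.
have yfacts y : Y0 <= y -> 1 <= y /\ D + 3 <= e * y.
  move=> hy; have de0 : 0 <= (D + 3) / e by rewrite divr_ge0 ?ltW//; lra.
  split; first by move: hy; rewrite /Y0; lra.
  have : (D + 3) / e <= y by move: hy; rewrite /Y0; lra.
  by rewrite ler_pdivrMr// mulrC.
have I0 x : 0 < x -> 0 < limn (pseries (powers_coef c kappa) x).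
  move=> x0; apply: lt_le_trans (term_le_lim c kappa x 0 kappa0 c0' (ltW x0) (cv x x0)).
  by rewrite mulr_gt0// exprn_gt0.
have y3 (y : R) : 1 <= y -> y <= y ^+ 3 by move=> y1; apply: ler_eXnr.
have y4 (y : R) : 1 <= y -> y <= y ^+ 4 by move=> y1; apply: ler_eXnr.
split; apply/eqO_exP.
- exists ((kappa%:R * e + 1) * expR (D + 1) * (8 / e) ^+ 2).
    rewrite mulr_gt0 ?exprn_gt0 ?divr_gt0// mulr_gt0 ?expR_gt0//; lra.
  near=> x.
  have [y Yy [x0 xE etaE sE]] : exists2 y : R, Y0 <= y &
    [/\ 0 < x, x = y ^+ 4, x `^ (- 4^-1) = y^-1 & x `^ 2^-1 = y ^+ 2] by near: x.
  have [y1 yD] := yfacts y Yy.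
  have y0 : 0 < y by lra.
  set I := limn _.
  have Ip : 0 < I by exact: I0.
  have key : lower_sum (powers_coef c kappa)
      (n_minus ((kappa%:R * e) *: 'X) 2 4^-1 x) x <=
      (kappa%:R * e * x + 1) *
      (expR (D + 1) * expR (- (e * x * (y^-1) ^+ 2)) * I).
    rewrite /n_minus fE etaE; apply: lower_sum_le.
    - by rewrite !mulr_ge0 ?expR_ge0// ltW.
    - by rewrite mulr_ge0// ltW.
    - rewrite ler_piMr//; first by rewrite mulr_ge0// ltW.
      by rewrite gerBl mulr_ge0// invr_ge0 ltW.
    move=> n hn; rewrite /powers_coef; case: ifP => [/dvdnP[k nE]|_]; last first.
      by rewrite mul0r !mulr_ge0 ?expR_ge0// ltW.
    rewrite nE mulnK// [in X in _ ^+ X]mulnC.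
    apply: (lower_tail_term c kappa e D x y^-1) => //.
    - by rewrite invr_ge0 ltW//= invf_le1.
    - rewrite xE (_ : e * y ^+ 4 / y = e * y ^+ 3); last by field; rewrite gt_eqF.
      have := y3 y y1; nra.
    - move: hn; rewrite nE natrM mulrC -!mulrA ler_pM2l ?ltr0n//.
    - exact: cv.
  have lsp : 0 <= lower_sum (powers_coef c kappa)
      (n_minus ((kappa%:R * e) *: 'X) 2 4^-1 x) x.
    by apply: sumr_ge0 => i _; rewrite mulr_ge0 ?exprn_ge0 ?powers_coef_ge0 ?ltW.
  rewrite ger0_norm; last by rewrite mulr_ge0// invr_ge0 ltW.
  rewrite ger0_norm ?expR_ge0// mulrC ler_pdivrMr//.
  apply: le_trans key _.
  rewrite sE -/I xE.
  have qE : e * y ^+ 4 * y^-1 ^+ 2 = e * y ^+ 2 by field; rewrite gt_eqF.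
  rewrite qE mulrA ler_pM2r// mulrA.
  have h1 : kappa%:R * e * y ^+ 4 + 1 <= (kappa%:R * e + 1) * y ^+ 4.
    rewrite mulrDl mul1r lerD2l; exact: le_trans (y4 y y1).
  have h2 : expR (- (e * y ^+ 2)) <= expR (- (e * y ^+ 2 / 2)).
    rewrite ler_expR lerN2; have := exprn_ge0 2 (ltW y0); nra.
  have h3 := le_expR_quarter e y e0 (ltW y0).
  apply: (@le_trans _ _ ((kappa%:R * e + 1) * y ^+ 4 * expR (D + 1) *
      expR (- (e * y ^+ 2 / 2)))).
    apply: ler_pM; rewrite ?expR_ge0//; last by rewrite ler_pM2r ?expR_gt0.
    by rewrite mulr_ge0 ?expR_ge0// addr_ge0// mulr_ge0 ?exprn_ge0// ltW.
  rewrite [leLHS](_ : _ = (kappa%:R * e + 1) * expR (D + 1) *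
    (y ^+ 4 * expR (- (e * y ^+ 2 / 2)))); last by ring.
  rewrite -[leRHS]mulrA ler_wpM2l// mulr_ge0 ?expR_ge0// addr_ge0//.
  by rewrite mulr_ge0// ltW.
- exists (2 * expR (D + 3) * (8 / e) ^+ 2).
    by rewrite mulr_gt0 ?exprn_gt0 ?divr_gt0// mulr_gt0 ?expR_gt0.
  near=> x.
  have [y Yy [x0 xE etaE sE]] : exists2 y : R, Y0 <= y &
    [/\ 0 < x, x = y ^+ 4, x `^ (- 4^-1) = y^-1 & x `^ 2^-1 = y ^+ 2] by near: x.
  have [y1 yD] := yfacts y Yy.
  have y0 : 0 < y by lra.
  set I := limn (pseries _ _).
  have Ip : 0 < I by exact: I0.
  (* The floor in n_plus can lower the bound on n by 1, so it lowers the bound on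
     k = n / kappa by at most 1. *)
  pose m' := Num.truncn (e * x * (1 + 2 * y^-1) - 1).
  have exy : D + 3 <= e * x * y^-1.
    rewrite xE (_ : e * y ^+ 4 / y = e * y ^+ 3); last by field; rewrite gt_eqF.
    have := y3 y y1; nra.
  have yi0 : 0 < y^-1 by rewrite invr_gt0.
  have yi1 : y^-1 <= 1 by rewrite invf_le1.
  have ex0 : 0 < e * x by rewrite mulr_gt0.
  have m'1 : m'%:R <= e * x * (1 + 2 * y^-1) - 1.
    by rewrite /m' truncn_le; nra.
  have m'2 : e * x * (1 + 2 * y^-1) - 2 <= m'%:R.
    by have := truncnS_gt (e * x * (1 + 2 * y^-1) - 1); rewrite -/m' -natr1; lra.
  have /andP[usp key] : 0 <= upper_sum (powers_coef c kappa)
      (n_plus ((kappa%:R * e) *: 'X) 2 4^-1 x) x <=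
      (1 + y^-1^-1) * (expR (D + 3) * expR (- (e * x * (y^-1) ^+ 2 / 2))) * I.
    apply: (upper_sum_le c kappa _ m' x _ kappa0 c0' (ltW x0)).
      move=> k; rewrite /n_plus fE etaE => hk.
      rewrite -(ler_nat R); apply: le_trans m'1 _.
      have h1 := floorD1_gt (kappa%:R * e * x * (1 + 2 * y^-1)).
      have h2 : (Num.floor (kappa%:R * e * x * (1 + 2 * y^-1)) + 1)%:~R <=
          kappa%:R * k%:R + 1 :> R.
        rewrite -natrM intrD lerD2r -[X in _ <= X]/((kappa * k)%N%:Z%:~R).
        by rewrite ler_int.
      have h3 := lt_le_trans h1 h2.
      rewrite -(ler_pM2l (lt_le_trans ltr01 kR)) mulrBr mulr1.
      rewrite !mulrA; lra.
    by move=> M; apply: upper_tail_sum => //; [rewrite yi0 yi1 | exact: cv].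
  rewrite ger0_norm; last by rewrite mulr_ge0// invr_ge0 ltW.
  rewrite ger0_norm ?expR_ge0// mulrC ler_pdivrMr//.
  apply: le_trans key _.
  rewrite sE xE invrK.
  have qE : e * y ^+ 4 * y^-1 ^+ 2 / 2 = e * y ^+ 2 / 2 by field; rewrite gt_eqF.
  rewrite qE ler_pM2r// mulrA.
  have h1 : 1 + y <= 2 * y ^+ 4 by have := y4 y y1; lra.
  have h3 := le_expR_quarter e y e0 (ltW y0).
  apply: (@le_trans _ _ (2 * y ^+ 4 * expR (D + 3) *
      expR (- (e * y ^+ 2 / 2)))).
    by rewrite !ler_pM2r ?expR_gt0.
  rewrite [leLHS](_ : _ = 2 * expR (D + 3) *
    (y ^+ 4 * expR (- (e * y ^+ 2 / 2)))); last by ring.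
  by rewrite -[leRHS]mulrA ler_wpM2l// mulr_ge0 ?expR_ge0.
Unshelve. all: by end_near. Qed.

End concentration.

(** * Ratios of consecutive coefficients *)

Section coef_ratio.
Context {R : realType}.

Lemma powR_sum (x : R) n (F : 'I_n -> R) : 0 < x ->
  \prod_(i < n) x `^ F i = x `^ (\sum_(i < n) F i).
Proof.
move=> x0; symmetry; apply: (big_morph (fun s => x `^ s)); last exact: powRr0.
by move=> s t; rewrite powRD// implybE (gt_eqF x0) orbT.
Qed.

Lemma Gamma_prod_ratio n (c a : 'I_n -> R) (k : nat) :
  (forall i, 0 < c i) -> (0 < k)%N ->
  \prod_(i < n) (Gamma (c i * k.+1%:R + a i) / Gamma (c i * k%:R + a i)
    / (c i * k%:R) `^ c i) =
  (\prod_(i < n) Gamma (c i * k.+1%:R + a i)) /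
  (\prod_(i < n) Gamma (c i * k%:R + a i)) /
  ((\prod_(i < n) c i `^ c i) * k%:R `^ (\sum_(i < n) c i)).
Proof.
move=> c0 k0; have kR : 0 < k%:R :> R by rewrite ltr0n.
rewrite !prodf_div; congr (_ / _); rewrite -powR_sum// -big_split/=.
by apply: eq_bigr => i _; rewrite powRM// ltW.
Qed.

Lemma Gamma_prod_gt0 n (c a : 'I_n -> R) (k : nat) :
  (forall i, 0 < c i) -> (forall i, 0 < a i) ->
  0 < \prod_(i < n) Gamma (c i * k%:R + a i).
Proof.
move=> c0 a0; apply: prodr_gt0 => i _; apply: Gamma_gt0.
by rewrite ltr_wpDl// mulr_ge0// ltW.
Qed.

(** The powers of k from the Gamma ratios have exponents summing to - kappa, and
    the constants alpha ^ alpha and beta ^ (- beta) multiply to C. *)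
Lemma near_one_coef_ratio (p q : nat)
    (alpha a : 'I_p -> R) (beta b : 'I_q -> R) (T : R)
    (kappa : nat) (omega : nat -> R) :
  (forall r, 0 < alpha r) -> (forall r, 0 < a r) ->
  (forall s, 0 < beta s) -> (forall s, 0 < b s) -> 0 < T ->
  \sum_(s < q) beta s - \sum_(r < p) alpha r = kappa%:R ->
  (forall k, 0 < omega k) ->
  (fun k => omega k.+1 / omega k - 1) =O_\oo (fun k => k%:R^-1 : R) ->
  let C := (\prod_(r < p) alpha r `^ alpha r) *
           (\prod_(s < q) beta s `^ (- beta s)) in
  let c k := gamma_quotient alpha a beta b k * omega k * T ^+ (kappa * k) in
  near_one (fun k => c k.+1 / c k * k%:R ^+ kappa / (C * T ^+ kappa)).
Proof.
move=> alpha0 a0 beta0 b0 T0 kappaE omega0 omegaO C c.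
have := near_oneM _ _ (near_oneM _ _
  (near_one_prod _ _ (fun r => near_one_Gamma_ratio _ _ (alpha0 r) (a0 r)))
  (near_oneV _
    (near_one_prod _ _ (fun s => near_one_Gamma_ratio _ _ (beta0 s) (b0 s)))))
  (near_one_bigO _ omegaO).
apply: near_one_eq => k k0.
have kR : 0 < k%:R :> R by rewrite ltr0n.
rewrite !Gamma_prod_ratio// /c /gamma_quotient /C.
have -> : \sum_(s < q) beta s = \sum_(r < p) alpha r + kappa%:R.
  by rewrite -kappaE; ring.
have -> : \prod_(s < q) beta s `^ (- beta s) = (\prod_(s < q) beta s `^ beta s)^-1.
  by rewrite -prodfV; apply: eq_bigr => s _; rewrite powRN.
rewrite powRD; last by rewrite implybE (gt_eqF kR) orbT.
rewrite powR_mulrn; last exact: ltW.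
have := Gamma_prod_gt0 _ _ _ k.+1 alpha0 a0.
have := Gamma_prod_gt0 _ _ _ k alpha0 a0.
have := Gamma_prod_gt0 _ _ _ k.+1 beta0 b0.
have := Gamma_prod_gt0 _ _ _ k beta0 b0.
have : 0 < \prod_(r < p) alpha r `^ alpha r.
  by apply: prodr_gt0 => i _; rewrite powR_gt0.
have : 0 < \prod_(s < q) beta s `^ beta s.
  by apply: prodr_gt0 => i _; rewrite powR_gt0.
(* With the products abstracted, an identity between rational functions remains. *)
generalize (\prod_(r < p) alpha r `^ alpha r) (\prod_(s < q) beta s `^ beta s)
  (\prod_(r < p) Gamma (alpha r * k%:R + a r))
  (\prod_(r < p) Gamma (alpha r * k.+1%:R + a r))
  (\prod_(s < q) Gamma (beta s * k%:R + b s))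
  (\prod_(s < q) Gamma (beta s * k.+1%:R + b s)).
move=> CA CB PA PA1 PB PB1 CB0 CA0 PB0 PB10 PA0 PA10.
rewrite mulnS exprD.
have := exprn_gt0 kappa T0; have := exprn_gt0 (kappa * k) T0.
move: (T ^+ kappa) (T ^+ (kappa * k)) => TA TB TB0 TA0.
have := powR_gt0 (\sum_(r < p) alpha r) kR.
move: (k%:R `^ (\sum_(r < p) alpha r)) => S S0.
have := exprn_gt0 kappa kR; move: (k%:R ^+ kappa) => KK KK0.
have := omega0 k; have := omega0 k.+1.
move: (omega k) (omega k.+1) => w w' w0 w'0.
by field; rewrite !gt_eqF.
Qed.

End coef_ratio.

Theorem theorem1p2 (R : realType) (p q : nat)
    (alpha a : 'I_p -> R) (beta b : 'I_q -> R) (T : R)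
    (kappa : nat) (omega : nat -> R)
    (q_gt0 : (0 < q)%N)
    (alpha_gt0 : forall r, 0 < alpha r) (a_gt0 : forall r, 0 < a r)
    (beta_gt0 : forall s, 0 < beta s) (b_gt0 : forall s, 0 < b s)
    (T_gt0 : 0 < T)
    (kappa_gt0 : (0 < kappa)%N)
    (kappaE : \sum_(s < q) beta s - \sum_(r < p) alpha r = kappa%:R)
    (omega_gt0 : forall k, 0 < omega k)
    (omega_ratio : (fun k => omega k.+1 / omega k - 1)
       =O_\oo (fun k => k%:R^-1 : R)) :
  let C := (\prod_(r < p) alpha r `^ alpha r) *
           (\prod_(s < q) beta s `^ (- beta s)) in
  let H := powers_coef (fun k =>
    gamma_quotient alpha a beta b k * omega k * T ^+ (kappa * k)) kappa in
  concentrate_exponentially H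
    ((kappa%:R * C `^ (kappa%:R^-1) * T) *: 'X).
Proof.
move=> C H.
have C0 : 0 < C by rewrite mulr_gt0//; apply: prodr_gt0 => i _; rewrite powR_gt0.
pose c k := gamma_quotient alpha a beta b k * omega k * T ^+ (kappa * k).
have c0 k : 0 < c k.
  by rewrite /c mulr_gt0 ?exprn_gt0// mulr_gt0// divr_gt0// Gamma_prod_gt0.
have kR : 0 < kappa%:R :> R by rewrite ltr0n.
pose e := C `^ (kappa%:R^-1) * T.
have e0 : 0 < e by rewrite mulr_gt0// powR_gt0.
have eE : e ^+ kappa = C * T ^+ kappa.
  rewrite exprMn -[_ ^+ kappa in LHS]powR_mulrn ?powR_ge0// -powRrM mulVf ?gt_eqF//.
  by rewrite powRr1// ltW.
have E0 : 0 < C * T ^+ kappa by rewrite mulr_gt0// exprn_gt0.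
have [D D0 [lo hi]] := near_one_shift (fun k => c k.+1 / c k) _ _ kappa_gt0 E0
  (fun k => divr_gt0 (c0 k.+1) (c0 k))
  (near_one_coef_ratio _ _ _ _ _ _ _ _ _ alpha_gt0 a_gt0 beta_gt0 b_gt0
     T_gt0 kappaE omega_gt0 omega_ratio).
rewrite -mulrA -/e; apply: (concentrate_of_ratio c kappa e D) => // k.
  rewrite eE -ler_pdivlMr// -[leRHS]mulrA; exact: lo.
by move=> Dk; rewrite eE -ler_pdivrMr// -[leLHS]mulrA; exact: hi.
Qed.
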